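(* Let $n\in\mathbb{N}\setminus\{1\}$, let $E$ be a vector lattice, and let $V$ be a vector space. Let $P\colon E\to V$ be an $n$-homogeneous polynomial. Then $P$ is orthogonally additive if and only if $P$ is positively orthogonally additive.
   Context: $\mathbb{N}$ denotes the strictly positive integers. All vector spaces are real and all vector lattices are Archimedean. $E^+$ denotes the positive cone of $E$, and $f,g\in E$ are disjoint (written $f\perp g$) if $|f|\wedge|g|=0$. A map $P\colon E\to V$ is an $n$-homogeneous polynomial if there exists a (necessarily unique) symmetric $n$-linear map $\check{P}\colon E^n\to V$ such that $P(f)=\check{P}(f,\dots,f)$ for all $f\in E$. An $n$-homogeneous polynomial $P\colon E\to V$ is orthogonally additive if $P(f+g)=P(f)+P(g)$ holds whenever $f,g\in E$ are disjoint. It is positively orthogonally additive if $P(f+g)=P(f)+P(g)$ holds whenever $f,g\in E^+$ are disjoint. *)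

(* Defs.v *)
From HB Require Import structures.
From mathcomp Require Import all_boot all_order all_algebra all_fingroup.
From mathcomp Require Import reals.

Set Implicit Arguments.
Unset Strict Implicit.
Unset Printing Implicit Defensive.

Import Order.TTheory GRing.Theory Num.Theory.
Local Open Scope ring_scope.

HB.mixin Record POrderedLmodule_isVectorLattice (R : realType) E
    of Num.POrderedZmodule E & GRing.Lmodule R E := {
  vl_leD2l : forall z x y : E, x <= y -> z + x <= z + y ;
  vl_scale_ge0 : forall (a : R) (x : E), 0 <= a -> 0 <= x -> 0 <= a *: x ;
  vl_meet : E -> E -> E ;
  vl_join : E -> E -> E ;
  vl_lexI : forall x y z : E, (x <= vl_meet y z) = (x <= y) && (x <= z) ;
  vl_leUx : forall x y z : E, (vl_join x y <= z) = (x <= z) && (y <= z)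
}.

#[short(type="vectorLatticeType")]
HB.structure Definition VectorLattice (R : realType) :=
  { E of Num.POrderedZmodule E & GRing.Lmodule R E
       & POrderedLmodule_isVectorLattice R E }.

(* The lattice structure is attached here, rather than inherited, because a new
   structure inheriting from both Lattice and Zmodule is rejected: the existing
   Num.RealDomain inherits from both too. *)
HB.instance Definition _ (R : realType) (E : vectorLatticeType R) :=
  Order.POrder_MeetJoin_isLattice.Build ring_display (VectorLattice.sort E)
    (@vl_lexI R E) (@vl_leUx R E).

HB.mixin Record VectorLattice_isArchimedean (R : realType) E
    of VectorLattice R E := {
  vl_archimedean : forall x y : E,
    (forall k : nat, (0 < k)%N -> x *+ k <= y) -> x <= 0
}.

#[short(type="archiVectorLatticeType")]
HB.structure Definition ArchiVectorLattice (R : realType) :=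
  { E of VectorLattice R E & VectorLattice_isArchimedean R E }.

HB.instance Definition _ (R : realType) (E : archiVectorLatticeType R) :=
  Order.Lattice.copy (ArchiVectorLattice.sort E)
    (VectorLattice.sort (E : vectorLatticeType R)).

Section Disjointness.
Context {R : realType} {E : vectorLatticeType R}.

(* `|x| is not available here: it would require a scalar-valued norm. *)
Definition vl_abs (f : E) : E := (f `|` - f)%O.

Definition vl_disjoint (f g : E) : Prop := (vl_abs f `&` vl_abs g)%O = 0.

End Disjointness.

Section Polynomials.
Context {R : realType} {E V : lmodType R}.

(* E ^ n is {ffun 'I_n -> E}. *)
Definition multilinear_map (n : nat) (M : E ^ n -> V) : Prop :=
  forall (i : 'I_n) (x : E ^ n),
    linear (fun u : E => M [ffun j => if j == i then u else x j]).

Definition symmetric_map (n : nat) (M : E ^ n -> V) : Prop :=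
  forall (s : 'S_n) (x : E ^ n), M [ffun i => x (s i)] = M x.

Definition homogeneous_polynomial (n : nat) (P : E -> V) : Prop :=
  exists M : E ^ n -> V,
    [/\ multilinear_map M, symmetric_map M & forall f, P f = M [ffun=> f]].

End Polynomials.

Section OrthogonalAdditivity.
Context {R : realType} {E : vectorLatticeType R} {V : lmodType R}.

Definition orthogonally_additive (P : E -> V) : Prop :=
  forall f g : E, vl_disjoint f g -> P (f + g) = P f + P g.

Definition positively_orthogonally_additive (P : E -> V) : Prop :=
  forall f g : E, 0 <= f -> 0 <= g -> vl_disjoint f g ->
    P (f + g) = P f + P g.

End OrthogonalAdditivity.

(* Main.v *)
Require Import Defs.
From mathcomp Require Import all_boot all_order all_algebra.
From mathcomp Require Import reals.

(** Disjoint [f] and [g] are moved into the positive cone along a line.  Write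
    [f^+] and [f^-] for the positive and negative parts and put
    [f_t = f^+ + t f^-] and [g_t = g^+ + t g^-] for a real [t].  If [0 <= t],
    then [f_t] and [g_t] are positive and dominated by [(1 + t) |f|] and
    [(1 + t) |g|], hence disjoint ([disjoint_pos_neg_comb]), so positive
    orthogonal additivity says that
    [q(t) = P(f_t + g_t) - P(f_t) - P(g_t)] vanishes for all [t >= 0].
    But a multilinear map restricted to a line is a polynomial in [t] with
    vector coefficients ([multilinear_on_line]), and a polynomial that vanishes
    on the half-line is identically zero ([vector_poly_eq0]).  So [q(-1) = 0],
    and this is the wanted identity, since [f_{-1} = f] and [g_{-1} = g]. *)

Set Implicit Arguments.
Unset Strict Implicit.
Unset Printing Implicit Defensive.

Import Order.TTheory GRing.Theory Num.Theory.
Local Open Scope ring_scope.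

(** * Polynomials with vector coefficients *)

(** The operation [q(t) |-> q(2 t) - 2^m q(t)] preserves vanishing on the
    half-line, kills the term of degree [m], and multiplies the coefficient of
    degree [k < m] by [2^k - 2^m], which is nonzero.  This gives an induction on
    the degree that never leaves [V]. *)
Lemma vector_poly_eq0 (R : realType) (V : lmodType R) (m : nat)
    (v : nat -> V) :
  (forall t : R, 0 <= t -> \sum_(k < m) t ^+ k *: v k = 0) ->
  forall k, (k < m)%N -> v k = 0.
Proof.
elim: m v => [//|m IHm] v v0.
have low k : (k < m)%N -> v k = 0.
  move=> ltkm.
  have : (2 ^+ k - 2 ^+ m : R) *: v k = 0.
    apply: (IHm (fun k => (2 ^+ k - 2 ^+ m : R) *: v k)) => // t t0.
    have -> : \sum_(i < m) t ^+ i *: ((2 ^+ i - 2 ^+ m : R) *: v i) =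
        \sum_(i < m.+1) (2 * t) ^+ i *: v i
        - 2 ^+ m *: \sum_(i < m.+1) t ^+ i *: v i.
      rewrite scaler_sumr -sumrB [RHS]big_ord_recr /=.
      rewrite exprMn scalerA subrr addr0; apply: eq_bigr => i _.
      by rewrite !scalerA -scalerBl exprMn mulrBr ![t ^+ i * _]mulrC.
    by rewrite !v0 ?mulr_ge0 ?ler0n // scaler0 subr0.
  move/eqP; rewrite scaler_eq0 subr_eq0 -!natrX eqr_nat eqn_exp2l //.
  by rewrite (ltn_eqF ltkm) /= => /eqP.
move=> k; rewrite ltnS leq_eqVlt => /orP[/eqP->|]; last exact: low.
have := v0 1 ler01; rewrite big_ord_recr big1 /= => [|i _].
  by rewrite add0r expr1n scale1r.
by rewrite low // scaler0.
Qed.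

(** The coordinates are put on the line one at a time: by linearity in the
    [m]-th one, the value is [A(t) + t B(t)], where [A] and [B] have that
    coordinate frozen, so each coordinate raises the degree by at most one. *)
Lemma multilinear_on_line_prefix (R : realType) (E V : lmodType R) (n : nat)
    (M : E ^ n -> V) (x y : E ^ n) (m : nat) :
  multilinear_map M -> (m <= n)%N -> forall z : E ^ n,
  exists v : nat -> V, forall t : R,
    M [ffun j : 'I_n => if (j < m)%N then x j + t *: y j else z j] =
    \sum_(k < m.+1) t ^+ k *: v k.
Proof.
move=> Mlin; elim: m => [_ z|m IHm ltmn z].
  exists (fun=> M z) => t; rewrite big_ord1 expr0 scale1r; congr M.
  by apply/ffunP => j; rewrite ffunE.
pose i := Ordinal ltmn.
pose freeze (u : E) : E ^ n := [ffun j => if j == i then u else z j].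
have [a aE] := IHm (ltnW ltmn) (freeze (x i)).
have [b bE] := IHm (ltnW ltmn) (freeze (y i)).
exists (fun k => (if (k < m.+1)%N then a k else 0)
               + (if k is k'.+1 then b k' else 0)) => t.
pose w : E ^ n := [ffun j : 'I_n => if (j < m)%N then x j + t *: y j else z j].
have wE u : [ffun j => if j == i then u else w j] =
    [ffun j : 'I_n => if (j < m)%N then x j + t *: y j else freeze u j].
  apply/ffunP => j; rewrite !ffunE; case: eqVneq => [->|//].
  by rewrite ltnn.
have -> : [ffun j : 'I_n => if (j < m.+1)%N then x j + t *: y j else z j] =
    [ffun j => if j == i then t *: y i + x i else w j].
  apply/ffunP => j; rewrite !ffunE; case: eqVneq => [->|neji].
    by rewrite ltnSn addrC.
  by rewrite ltnS leq_eqVlt -[(j : nat) == m]/(j == i) (negbTE neji).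
rewrite (Mlin i w t (y i) (x i)) !wE aE bE addrC scaler_sumr.
under [RHS]eq_bigr do rewrite scalerDr.
rewrite big_split /=; congr (_ + _).
  rewrite [RHS]big_ord_recr /= ltnn scaler0 addr0.
  by apply: eq_bigr => k _; rewrite ltn_ord.
rewrite [RHS]big_ord_recl /= scaler0 add0r.
by apply: eq_bigr => k _; rewrite scalerA exprS.
Qed.

Lemma multilinear_on_line (R : realType) (E V : lmodType R) (n : nat)
    (M : E ^ n -> V) (x y : E) :
  multilinear_map M -> exists v : nat -> V, forall t : R,
    M [ffun=> x + t *: y] = \sum_(k < n.+1) t ^+ k *: v k.
Proof.
move=> Mlin.
have [v vE] := multilinear_on_line_prefix [ffun=> x] [ffun=> y] Mlin
                 (leqnn n) [ffun=> 0].
exists v => t; rewrite -vE; congr M.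
by apply/ffunP => j; rewrite !ffunE ltn_ord.
Qed.

(** * Positive and negative parts *)

Section PosNegParts.
Context {R : realType} {E : vectorLatticeType R}.
Implicit Types (f g h : E) (a t : R).

Definition vl_pos f : E := (f `|` 0)%O.
Definition vl_neg f : E := (- f `|` 0)%O.

Lemma vl_addr_ge0 f g : 0 <= f -> 0 <= g -> 0 <= f + g.
Proof.
move=> f0 g0; apply: (le_trans f0).
by rewrite -[leLHS]addr0; exact: vl_leD2l.
Qed.

Lemma vl_lerD f g f' g' : f <= f' -> g <= g' -> f + g <= f' + g'.
Proof.
move=> lef leg; apply: (@le_trans _ _ (f + g')); first exact: vl_leD2l.
by rewrite ![_ + g']addrC; exact: vl_leD2l.
Qed.

Lemma vl_ler_scale a f g : 0 <= a -> f <= g -> a *: f <= a *: g.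
Proof.
move=> a0 lefg.
have : 0 <= a *: (g - f).
  apply: vl_scale_ge0 => //.
  by have := vl_leD2l (- f) _ _ lefg; rewrite addNr addrC.
move/(vl_leD2l (a *: f)).
by rewrite addr0 scalerBr addrC subrK.
Qed.

Lemma vl_abs_ge0 f : 0 <= vl_abs f.
Proof.
have : 0 <= vl_abs f + vl_abs f.
  by rewrite -(subrr f); apply: vl_lerD; [exact: leUl|exact: leUr].
have half_ge0 : 0 <= 2^-1 :> R by rewrite invr_ge0 ler0n.
move/(vl_scale_ge0 _ _ half_ge0).
by rewrite -mulr2n -scaler_nat scalerA mulVf ?pnatr_eq0 // scale1r.
Qed.

Lemma vl_abs_id f : 0 <= f -> vl_abs f = f.
Proof.
move=> f0; apply/le_anti; rewrite leUl andbT leUx lexx /=.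
apply: (le_trans _ f0); have := vl_leD2l (- f) _ _ f0.
by rewrite addr0 addNr.
Qed.

Lemma vl_pos_ge0 f : 0 <= vl_pos f.
Proof. exact: leUr. Qed.

Lemma vl_neg_ge0 f : 0 <= vl_neg f.
Proof. exact: leUr. Qed.

Lemma vl_pos_le_abs f : vl_pos f <= vl_abs f.
Proof. by rewrite leUx vl_abs_ge0 leUl. Qed.

Lemma vl_neg_le_abs f : vl_neg f <= vl_abs f.
Proof. by rewrite leUx vl_abs_ge0 leUr. Qed.

(** Translation by [f] carries the join of [-f] and [0] to that of [0] and
    [f]. *)
Lemma vl_posBneg f : vl_pos f - vl_neg f = f.
Proof.
suff -> : vl_pos f = f + vl_neg f by rewrite addrK.
apply/le_anti/andP; split.
  rewrite leUx -{1}[f]addr0 vl_leD2l ?vl_neg_ge0 //=.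
  by rewrite -(subrr f) vl_leD2l // leUl.
rewrite -[leRHS](addNKr f) vl_leD2l // leUx.
rewrite -{1}[- f]addr0 vl_leD2l ?vl_pos_ge0 //=.
by rewrite -(addNr f) vl_leD2l // leUl.
Qed.

Definition pos_neg_comb t f : E := vl_pos f + t *: vl_neg f.

Lemma pos_neg_comb_ge0 t f : 0 <= t -> 0 <= pos_neg_comb t f.
Proof.
move=> t0; apply: vl_addr_ge0; first exact: vl_pos_ge0.
by apply: vl_scale_ge0 => //; exact: vl_neg_ge0.
Qed.

Lemma pos_neg_comb_le t f : 0 <= t -> pos_neg_comb t f <= (1 + t) *: vl_abs f.
Proof.
move=> t0; rewrite scalerDl scale1r.
by apply: vl_lerD (vl_pos_le_abs f) (vl_ler_scale t0 (vl_neg_le_abs f)).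
Qed.

(** A lower bound [h] of [c |f|] and [c |g|], with [c > 0], satisfies
    [c^-1 h <= |f| /\ |g| = 0]. *)
Lemma disjoint_pos_neg_comb t f g : 0 <= t -> vl_disjoint f g ->
  vl_disjoint (pos_neg_comb t f) (pos_neg_comb t g).
Proof.
move=> t0 fg0; rewrite /vl_disjoint !vl_abs_id ?pos_neg_comb_ge0 //.
set h := (_ `&` _)%O.
apply/le_anti; rewrite lexI !pos_neg_comb_ge0 // !andbT.
have c0 : 0 < 1 + t by rewrite ltr_wpDr.
have ci0 : 0 <= (1 + t)^-1 by rewrite invr_ge0 ltW.
have descale k : h <= (1 + t) *: k -> (1 + t)^-1 *: h <= k.
  by move/(vl_ler_scale ci0); rewrite scalerA mulVf ?gt_eqF // scale1r.
have : (1 + t)^-1 *: h <= 0.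
  rewrite -[leRHS]fg0 lexI; apply/andP.
  split; apply: descale; apply: (le_trans _ (pos_neg_comb_le _ t0)).
    exact: leIl.
  exact: leIr.
move/(vl_ler_scale (ltW c0)).
by rewrite scalerA mulfV ?gt_eqF // scale1r scaler0.
Qed.

End PosNegParts.

(** * Orthogonal additivity *)

Theorem lemma2p1 (R : realType) (n : nat) (hn : (1 < n)%N)
    (E : archiVectorLatticeType R) (V : lmodType R) (P : E -> V)
    (hP : homogeneous_polynomial n P) :
  orthogonally_additive P <-> positively_orthogonally_additive P.
Proof.
split=> [Padd f g _ _|Padd f g fg0]; first exact: Padd.
have [M [Mlin _ PE]] := hP.
have [a aE] := multilinear_on_line (vl_pos f + vl_pos g)
                 (vl_neg f + vl_neg g) Mlin.
have [b bE] := multilinear_on_line (vl_pos f) (vl_neg f) Mlin.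
have [c cE] := multilinear_on_line (vl_pos g) (vl_neg g) Mlin.
have combD t : pos_neg_comb t f + pos_neg_comb t g =
    (vl_pos f + vl_pos g) + t *: (vl_neg f + vl_neg g).
  by rewrite addrACA scalerDr.
have defectE t :
    P (pos_neg_comb t f + pos_neg_comb t g)
      - (P (pos_neg_comb t f) + P (pos_neg_comb t g)) =
    \sum_(k < n.+1) t ^+ k *: (a k - (b k + c k)).
  rewrite combD !PE aE bE cE -big_split -sumrB.
  by apply: eq_bigr => k _; rewrite scalerBr scalerDr.
have coef0 : forall k, (k < n.+1)%N -> a k - (b k + c k) = 0.
  apply: vector_poly_eq0 => t t0; rewrite -defectE Padd ?subrr //.
  - exact: pos_neg_comb_ge0.
  - exact: pos_neg_comb_ge0.
  - exact: disjoint_pos_neg_comb.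
have combN1 h : pos_neg_comb (-1) h = h.
  by rewrite /pos_neg_comb scaleN1r vl_posBneg.
have := defectE (-1); rewrite !combN1 big1 => [/subr0_eq //|k _].
by rewrite coef0 ?scaler0.
Qed.
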